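(* Let $\alpha,\beta\in\mathcal{F}_{\sim}$ and $\gamma,\delta\in\mathcal{F}_{\neg}$. (1) For every approximation space $(U,R)$ and every valuation $v$ in $\mathcal{RS}_{\sim}$ one has $v(\alpha)\le v(\beta)$ (that is, $\alpha\vdash\beta$ is valid in the class of all Stone algebras $\mathcal{RS}_{\sim}$ formed by rough sets) if and only if $\alpha\vdash\beta$ is valid in the class of all approximation spaces, i.e. $\alpha\vDash^{\mathcal{RS}_{\sim}}_{1}\beta$ for every approximation space $(U,R)$. (2) For every approximation space $(U,R)$ and every valuation $v$ in $\mathcal{RS}_{\neg}$ one has $v(\gamma)\le v(\delta)$ (that is, $\gamma\vdash\delta$ is valid in the class of all dual Stone algebras $\mathcal{RS}_{\neg}$ formed by rough sets) if and only if $\gamma\vdash\delta$ is valid in the class of all approximation spaces, i.e. $\gamma\vDash^{\mathcal{RS}_{\neg}}_{0}\delta$ for every approximation space $(U,R)$.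
   Context: An approximation space is a pair $(U,R)$ with $U$ a set and $R$ an equivalence relation on $U$; $[x]$ denotes the class of $x$. For $A\subseteq U$, $\mathsf{L}A:=\bigcup\{[x]:[x]\subseteq A\}$ and $\mathsf{U}A:=\bigcup\{[x]:[x]\cap A\ne\emptyset\}$. $\mathcal{RS}:=\{(\mathsf{L}A,\mathsf{U}A):A\subseteq U\}$ is ordered by componentwise inclusion, with componentwise union and intersection as $\vee,\wedge$, bottom $0=(\emptyset,\emptyset)$, top $1=(U,U)$. $\mathcal{RS}_{\sim}$ is the Stone algebra formed by $\mathcal{RS}$, with $\sim(\mathsf{L}A,\mathsf{U}A)=((\mathsf{U}A)^{c},(\mathsf{U}A)^{c})$; $\mathcal{RS}_{\neg}$ is the dual Stone algebra formed by $\mathcal{RS}$, with $\neg(\mathsf{L}A,\mathsf{U}A)=((\mathsf{L}A)^{c},(\mathsf{L}A)^{c})$. Formulas $\mathcal{F}_{\sim}$ (resp. $\mathcal{F}_{\neg}$): built from propositional variables $p,q,r,\ldots$ and constants $\top,\bot$ with $\vee,\wedge$ and the unary connective $\sim$ (resp. $\neg$). A valuation in $\mathcal{RS}_{\sim}$ (resp. $\mathcal{RS}_{\neg}$) is a map $v$ from formulas to that algebra preserving $\vee,\wedge$ and the unary connective, with $v(\bot)=0$, $v(\top)=1$. For a valuation $v$ in $\mathcal{RS}_{\sim}$ (resp. $\mathcal{RS}_{\neg}$) with $v(\varphi)=(\mathsf{L}A,\mathsf{U}A)$ and $x\in U$: $v,x\vDash_{1}\varphi$ iff $x\in\mathsf{L}A$;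 $v,x\vDash_{0}\varphi$ iff $x\notin\mathsf{U}A$. $\alpha\vDash^{\mathcal{RS}_{\sim}}_{1}\beta$ means: for all valuations $v$ in $\mathcal{RS}_{\sim}$ and all $x\in U$, $v,x\vDash_{1}\alpha$ implies $v,x\vDash_{1}\beta$. $\gamma\vDash^{\mathcal{RS}_{\neg}}_{0}\delta$ means: for all valuations $v$ in $\mathcal{RS}_{\neg}$ and all $x\in U$, $v,x\vDash_{0}\delta$ implies $v,x\vDash_{0}\gamma$. *)

(* Defs.v *)
From HB Require Import structures.
From mathcomp Require Import all_boot all_order.
From mathcomp Require Import boolp classical_sets.
From Stdlib Require Import RelationClasses.

Set Implicit Arguments.
Unset Strict Implicit.
Unset Printing Implicit Defensive.

Import Order.TTheory.
Local Open Scope classical_set_scope.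

Record approxSpace := ApproxSpace {
  carrier :> Type;
  indisc : carrier -> carrier -> Prop;
  indisc_equiv : Equivalence indisc }.

Definition eq_class (U : approxSpace) (x : U) : set U := [set y | indisc x y].

Definition lower (U : approxSpace) (A : set U) : set U :=
  \bigcup_(x in [set x | eq_class x `<=` A]) eq_class x.

Definition upper (U : approxSpace) (A : set U) : set U :=
  \bigcup_(x in [set x | eq_class x `&` A !=set0]) eq_class x.

Definition rough_pair (U : approxSpace) (A : set U) : set U *p set U :=
  (lower A, upper A).

Definition is_rough (U : approxSpace) : {pred set U *p set U} :=
  [pred P | `[< exists A : set U, P = rough_pair A >]].

Section RoughSetsClosed.
Variable U : approxSpace.
Implicit Types (A X Y : set U) (x y z : U) (P Q : set U *p set U).

Let Rrefl x : indisc x x.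
Proof. by apply: (@Equivalence_Reflexive _ _ (indisc_equiv U)). Qed.
Let Rsym x y : indisc x y -> indisc y x.
Proof. by apply: (@Equivalence_Symmetric _ _ (indisc_equiv U)). Qed.
Let Rtrans y x z : indisc x y -> indisc y z -> indisc x z.
Proof. by apply: (@Equivalence_Transitive _ _ (indisc_equiv U)). Qed.

Lemma lowerP A x : lower A x <-> eq_class x `<=` A.
Proof.
split=> [[y yA xy] z xz|xA]; first by apply: yA; apply: Rtrans xy xz.
by exists x => //; apply: Rrefl.
Qed.

Lemma upperP A x : upper A x <-> exists2 y, indisc x y & A y.
Proof.
split=> [[y [z [yz Az]] xy]|[y xy Ay]].
  by exists z => //; apply: Rtrans (Rsym xy) yz.
by exists x; [exists y | apply: Rrefl].
Qed.

Definition saturated X := forall x y, indisc x y -> X x -> X y.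

Lemma lower_saturated A : saturated (lower A).
Proof.
by move=> x y xy /lowerP xA; apply/lowerP => z yz; apply: xA; apply: Rtrans yz.
Qed.

Lemma upper_saturated A : saturated (upper A).
Proof.
move=> x y xy /upperP[z xz Az]; apply/upperP; exists z => //.
exact: Rtrans (Rsym xy) xz.
Qed.

Lemma class_representatives :
  exists T : set U, (forall x, exists2 y, indisc x y & T y) /\
    (forall x y, T x -> T y -> indisc x y -> x = y).
Proof.
have [f fP] : exists f : {S : set U | S !=set0} -> U, forall S, sval S (f S).
  have /choice[f fP] : forall S : {S : set U | S !=set0}, exists x, sval S x.
    by case=> S [x Sx]; exists x.
  by exists f.
have ne x : eq_class x !=set0 by exists x; apply: Rrefl.
pose r x := f (exist _ (eq_class x) (ne x)).
have rP x : indisc x (r x) by apply: (fP (exist _ (eq_class x) (ne x))).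
exists (range r); split=> [x|_ _ [x _ <-] [y _ <-] xy]; first by exists (r x).
rewrite /r; congr f; apply: eq_exist.
have {}xy : indisc x y by apply: Rtrans (rP x) (Rtrans xy (Rsym (rP y))).
by apply/seteqP; split=> z; apply: Rtrans; [apply: Rsym|].
Qed.

(* Pairs of saturated sets X `<=` Y such that every element of Y with a
   singleton class is in X; this gives closure under join and meet, which is
   not obvious from the definition. *)
Lemma is_roughP P : reflect
  [/\ saturated P.1, saturated P.2, P.1 `<=` P.2 &
      forall x, P.2 x -> (forall y, indisc x y -> y = x) -> P.1 x]
  (P \in @is_rough U).
Proof.
apply: (iffP (asboolP _)).
  case=> A -> /=; split.
  - exact: lower_saturated.
  - exact: upper_saturated.
  - move=> x /lowerP xA; apply/upperP; exists x; first exact: Rrefl.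
    by apply: xA; apply: Rrefl.
  - by move=> x /upperP[y xy Ay] xs; apply/lowerP => z /xs ->; rewrite -(xs y).
case: P => X Y /= [sX sY XY single].
have [T [Tex Tuniq]] := class_representatives.
exists (X `|` (Y `&` T)); congr pair; apply/seteqP; split=> x.
- by move=> Xx; apply/lowerP => y xy; left; apply: sX Xx.
- move=> /lowerP xA; apply: contrapT => nXx.
  have nX y : indisc x y -> ~ X y by move=> xy /(sX _ _ (Rsym xy)).
  have inYT y : indisc x y -> Y y /\ T y by move=> xy; case: (xA y xy) => // /nX.
  have [Yx Tx] := inYT x (Rrefl x).
  apply: nXx; apply: single => // y xy.
  have [_ Ty] := inYT y xy.
  by apply: Tuniq => //; apply: Rsym.
- move=> Yx; apply/upperP; have [y xy Ty] := Tex x.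
  by exists y => //; right; split=> //; apply: sY Yx.
- by move=> /upperP[y /Rsym yx [/XY|[]] Yy *]; apply: sY yx Yy.
Qed.

Fact is_rough_meet : {in @is_rough U &, forall P Q, (P `&` Q)%O \in @is_rough U}.
Proof.
move=> P Q /is_roughP[P1 P2 P12 Ps] /is_roughP[Q1 Q2 Q12 Qs].
apply/is_roughP; split.
- by move=> x y xy [Px Qx]; split; [apply: P1 Px | apply: Q1 Qx].
- by move=> x y xy [Px Qx]; split; [apply: P2 Px | apply: Q2 Qx].
- by move=> x [Px Qx]; split; [apply: P12 | apply: Q12].
- by move=> x [Px Qx] xs; split; [apply: Ps | apply: Qs].
Qed.

Fact is_rough_join : {in @is_rough U &, forall P Q, (P `|` Q)%O \in @is_rough U}.
Proof.
move=> P Q /is_roughP[P1 P2 P12 Ps] /is_roughP[Q1 Q2 Q12 Qs].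
apply/is_roughP; split.
- by move=> x y xy [Px|Qx]; [left; apply: P1 Px | right; apply: Q1 Qx].
- by move=> x y xy [Px|Qx]; [left; apply: P2 Px | right; apply: Q2 Qx].
- by move=> x [Px|Qx]; [left; apply: P12 | right; apply: Q12].
- by move=> x [Px|Qx] xs; [left; apply: Ps | right; apply: Qs].
Qed.

Fact is_rough0 : \bot%O \in @is_rough U.
Proof. by apply/is_roughP; split. Qed.

Fact is_rough1 : \top%O \in @is_rough U.
Proof. by apply/is_roughP; split. Qed.

Fact is_rough_pseudocompl P :
  P \in @is_rough U -> ((~` P.2, ~` P.2) : set U *p set U) \in @is_rough U.
Proof.
move=> /is_roughP[_ s2 _ _].
by apply/is_roughP; split=> //= x y xy nx /(s2 _ _ (Rsym xy)).
Qed.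

Fact is_rough_dual_pseudocompl P :
  P \in @is_rough U -> ((~` P.1, ~` P.1) : set U *p set U) \in @is_rough U.
Proof.
move=> /is_roughP[s1 _ _ _].
by apply/is_roughP; split=> //= x y xy nx /(s1 _ _ (Rsym xy)).
Qed.

End RoughSetsClosed.

HB.instance Definition _ (U : approxSpace) :=
  Order.isMeetLatticeClosed.Build _ _ (@is_rough U) (@is_rough_meet U).
HB.instance Definition _ (U : approxSpace) :=
  Order.isJoinLatticeClosed.Build _ _ (@is_rough U) (@is_rough_join U).
HB.instance Definition _ (U : approxSpace) :=
  Order.isBLatticeClosed.Build _ _ (@is_rough U) (is_rough0 U).
HB.instance Definition _ (U : approxSpace) :=
  Order.isTLatticeClosed.Build _ _ (@is_rough U) (is_rough1 U).

Record RS (U : approxSpace) := MkRS {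
  rs_val : set U *p set U;
  rs_valP : rs_val \in @is_rough U }.

(* The bounded lattice structure of RS is inherited from the product order on
   pairs of sets: componentwise inclusion, union and intersection, with bounds
   (set0, set0) and (setT, setT). *)
HB.instance Definition _ (U : approxSpace) := [isSub for @rs_val U].
HB.instance Definition _ (U : approxSpace) := [Choice of RS U by <:].
Fact rs_display : Order.disp_t. Proof. exact: Order.Disp tt tt. Qed.
HB.instance Definition _ (U : approxSpace) :=
  [SubChoice_isTBSubLattice of RS U by <: with rs_display].

Section RoughSetAlgebras.
Variable U : approxSpace.
Implicit Types P Q S : RS U.

(* If P = rs_of A then rs_lo P = lower A and rs_up P = upper A. *)
Definition rs_lo P : set U := (rs_val P).1.
Definition rs_up P : set U := (rs_val P).2.

Definition rs_of (A : set U) : RS U.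
Proof.
by exists (rough_pair A); apply/asboolP; exists A.
Defined.

Lemma rs_ofP P : exists A : set U, P = rs_of A.
Proof.
by case: (asboolP _ (rs_valP P)) => A PA; exists A; apply: val_inj.
Qed.

Lemma rs_leP P Q :
  reflect (rs_lo P `<=` rs_lo Q /\ rs_up P `<=` rs_up Q) (P <= Q)%O.
Proof.
have -> : (P <= Q)%O = ((rs_lo P <= rs_lo Q) && (rs_up P <= rs_up Q))%O by [].
by apply: (iffP andP); rewrite !subsetEset.
Qed.

Lemma rs_eq P Q : rs_lo P = rs_lo Q -> rs_up P = rs_up Q -> P = Q.
Proof.
rewrite /rs_lo /rs_up => e1 e2; apply: val_inj => /=.
by move: e1 e2; case: (rs_val P) (rs_val Q) => [? ?] [? ?] /= -> ->.
Qed.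

Lemma rs_loU P Q : rs_lo (P `|` Q)%O = rs_lo P `|` rs_lo Q. Proof. by []. Qed.
Lemma rs_upU P Q : rs_up (P `|` Q)%O = rs_up P `|` rs_up Q. Proof. by []. Qed.
Lemma rs_loI P Q : rs_lo (P `&` Q)%O = rs_lo P `&` rs_lo Q. Proof. by []. Qed.
Lemma rs_upI P Q : rs_up (P `&` Q)%O = rs_up P `&` rs_up Q. Proof. by []. Qed.
Lemma rs_lo0 : rs_lo (\bot%O : RS U) = set0. Proof. by []. Qed.
Lemma rs_up0 : rs_up (\bot%O : RS U) = set0. Proof. by []. Qed.
Lemma rs_lo1 : rs_lo (\top%O : RS U) = setT. Proof. by []. Qed.
Lemma rs_up1 : rs_up (\top%O : RS U) = setT. Proof. by []. Qed.

Definition rsE :=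
  (rs_loU, rs_upU, rs_loI, rs_upI, rs_lo0, rs_up0, rs_lo1, rs_up1).

Definition pseudocompl P : RS U := MkRS (is_rough_pseudocompl (rs_valP P)).

Definition dual_pseudocompl P : RS U :=
  MkRS (is_rough_dual_pseudocompl (rs_valP P)).

Lemma rs_meetUl : left_distributive (@Order.meet _ (RS U)) Order.join.
Proof. by move=> P Q S; apply: rs_eq; rewrite !rsE; apply: setIUl. Qed.

Lemma rs_joinIl : left_distributive (@Order.join _ (RS U)) Order.meet.
Proof. by move=> P Q S; apply: rs_eq; rewrite !rsE; apply: setUIl. Qed.

Lemma rs_sub P : rs_lo P `<=` rs_up P.
Proof. by case/is_roughP: (rs_valP P). Qed.

Lemma pseudocomplP P Q : (P `&` Q)%O = \bot%O <-> (Q <= pseudocompl P)%O.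
Proof.
split=> [/(congr1 rs_up)|/rs_leP[_ QP]].
  rewrite !rsE => PQ.
  have QP : rs_up Q `<=` ~` rs_up P.
    by move=> x Qx Px; rewrite -[False]/(set0 x) -PQ.
  by apply/rs_leP; split=> // x /rs_sub; apply: QP.
have PQ : rs_up P `&` rs_up Q `<=` set0 by move=> x [Px /QP].
apply: rs_eq; rewrite !rsE; apply/seteqP; split=> //.
by move=> x [/rs_sub Px /rs_sub Qx]; apply: (PQ x).
Qed.

Lemma stone_identity P :
  (pseudocompl P `|` pseudocompl (pseudocompl P))%O = \top%O.
Proof. by apply: rs_eq; rewrite !rsE; apply: setUv. Qed.

Lemma dual_pseudocomplP P Q :
  (P `|` Q)%O = \top%O <-> (dual_pseudocompl P <= Q)%O.
Proof.
split=> [/(congr1 rs_lo)|/rs_leP[PQ _]].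
  rewrite !rsE => PQ.
  have {}PQ : ~` rs_lo P `<=` rs_lo Q.
    move=> x nPx; have : [set: U] x by [].
    by rewrite -PQ => -[].
  by apply/rs_leP; split=> // x /PQ /rs_sub.
have {}PQ : setT `<=` rs_lo P `|` rs_lo Q.
  by move=> x _; have [|/PQ] := pselect (rs_lo P x); [left | right].
apply: rs_eq; rewrite !rsE; apply/seteqP; split=> //.
by move=> x /PQ[/rs_sub|/rs_sub]; [left | right].
Qed.

Lemma dual_stone_identity P :
  (dual_pseudocompl P `&` dual_pseudocompl (dual_pseudocompl P))%O = \bot%O.
Proof. by apply: rs_eq; rewrite !rsE; apply: setICr. Qed.

End RoughSetAlgebras.

HB.instance Definition _ (U : approxSpace) :=
  Order.Lattice_isDistributive.Build rs_display (RS U)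
    (@rs_meetUl U) (@rs_joinIl U).

Inductive negation := Sim | Neg.

(* [formula Sim] and [formula Neg] are two distinct languages: the unary
   connective [Un] is read as the pseudocomplement, resp. its dual. *)
Inductive formula (c : negation) :=
  | Var of nat
  | Top
  | Bot
  | Or of formula c & formula c
  | And of formula c & formula c
  | Un of formula c.

Definition rs_compl (c : negation) (U : approxSpace) : RS U -> RS U :=
  match c with Sim => @pseudocompl U | Neg => @dual_pseudocompl U end.

Record valuation (c : negation) (U : approxSpace) := Valuation {
  val_fun :> formula c -> RS U;
  val_or : forall a b, val_fun (Or a b) = (val_fun a `|` val_fun b)%O;
  val_and : forall a b, val_fun (And a b) = (val_fun a `&` val_fun b)%O;
  val_un : forall a, val_fun (Un a) = rs_compl c (val_fun a);
  val_bot : val_fun (Bot c) = \bot%O;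
  val_top : val_fun (Top c) = \top%O }.

Section Semantics.
Variables (c : negation) (U : approxSpace).

Definition sat1 (v : valuation c U) (x : U) (a : formula c) : Prop :=
  rs_lo (v a) x.

Definition sat0 (v : valuation c U) (x : U) (a : formula c) : Prop :=
  ~ rs_up (v a) x.

Definition entails1 (a b : formula c) : Prop :=
  forall (v : valuation c U) (x : U), sat1 v x a -> sat1 v x b.

Definition entails0 (a b : formula c) : Prop :=
  forall (v : valuation c U) (x : U), sat0 v x b -> sat0 v x a.

End Semantics.

Arguments entails1 {c} U a b.
Arguments entails0 {c} U a b.

(* Main.v *)
(** In a Stone algebra the double complement [a |-> ~~a] is an endomorphism; on
    rough sets it sends [(LA, UA)] to [(UA, UA)]. Composing a valuation with it
    therefore gives a valuation whose first component is the second component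
    of the original one, so testing first components under all valuations
    already tests both. The dual double complement sends [(LA, UA)] to
    [(LA, LA)] and exchanges the roles of the components. *)

Require Import Defs.
From mathcomp Require Import all_boot all_order.
From mathcomp Require Import boolp classical_sets.

Set Implicit Arguments.
Unset Strict Implicit.
Unset Printing Implicit Defensive.

Local Open Scope classical_set_scope.

Section DoubleComplement.
Variables (c : negation) (U : approxSpace).
Implicit Types P Q : RS U.

Definition rs_compl2 P : RS U := rs_compl c (rs_compl c P).

Definition kept_component P : set U :=
  match c with Sim => rs_up P | Neg => rs_lo P end.

Lemma rs_lo_compl2 P : rs_lo (rs_compl2 P) = kept_component P.
Proof. by rewrite /rs_compl2 /kept_component; case: c; apply: setCK. Qed.

Lemma rs_up_compl2 P : rs_up (rs_compl2 P) = kept_component P.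
Proof. by rewrite /rs_compl2 /kept_component; case: c; apply: setCK. Qed.

(** Joins and meets are computed coordinatewise and [kept_component] is one of the coordinates, so
    it commutes with them. *)
Lemma rs_compl2U P Q :
  rs_compl2 (P `|` Q)%O = (rs_compl2 P `|` rs_compl2 Q)%O.
Proof.
by apply: rs_eq; rewrite !rsE ?rs_lo_compl2 ?rs_up_compl2 /kept_component;
  case: c.
Qed.

Lemma rs_compl2I P Q :
  rs_compl2 (P `&` Q)%O = (rs_compl2 P `&` rs_compl2 Q)%O.
Proof.
by apply: rs_eq; rewrite !rsE ?rs_lo_compl2 ?rs_up_compl2 /kept_component;
  case: c.
Qed.

Lemma rs_compl2_bot : rs_compl2 \bot%O = \bot%O.
Proof.
by apply: rs_eq; rewrite !rsE ?rs_lo_compl2 ?rs_up_compl2 /kept_component;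
  case: c.
Qed.

Lemma rs_compl2_top : rs_compl2 \top%O = \top%O.
Proof.
by apply: rs_eq; rewrite !rsE ?rs_lo_compl2 ?rs_up_compl2 /kept_component;
  case: c.
Qed.

Lemma valuation_compl2 (v : valuation c U) :
  exists w : valuation c U, forall a, w a = rs_compl2 (v a).
Proof.
unshelve eexists; first apply: (@Valuation c U (fun a => rs_compl2 (v a))).
- by move=> a b; rewrite val_or rs_compl2U.
- by move=> a b; rewrite val_and rs_compl2I.
(* Both sides are the triple complement of [v a]. *)
- by move=> a; rewrite val_un.
- by rewrite val_bot rs_compl2_bot.
- by rewrite val_top rs_compl2_top.
- by [].
Qed.

End DoubleComplement.

(** The equivalence already holds space by space, since the doubly complemented valuation lives on
    the same [U]. *)
Lemma le_entails1 (U : approxSpace) (a b : formula Sim) :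
  (forall v : valuation Sim U, (v a <= v b)%O) <-> entails1 U a b.
Proof.
split=> [le_ab v x|ab v]; first by have /rs_leP[lo_ab _] := le_ab v; apply: lo_ab.
apply/rs_leP; split=> x; first exact: ab.
(* For upper parts, test [w]: its lower part is the upper part of [v]. *)
have [w wE] := valuation_compl2 v.
by have := ab w x; rewrite /sat1 !wE !rs_lo_compl2.
Qed.

Lemma le_entails0 (U : approxSpace) (a b : formula Neg) :
  (forall v : valuation Neg U, (v a <= v b)%O) <-> entails0 U a b.
Proof.
split=> [le_ab v x|ab v].
  by have /rs_leP[_ up_ab] := le_ab v; apply/contra_not/up_ab.
(* [sat0] is non-membership, so entailment gives the upper inclusion by contraposition; the lower
   one needs [w]. *)
apply/rs_leP; split=> x; last by apply: contraPP; apply: ab.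
have [w wE] := valuation_compl2 v.
by apply: contraPP; have := ab w x; rewrite /sat0 !wE !rs_up_compl2.
Qed.

Theorem theorem11 (alpha beta : formula Sim) (gamma delta : formula Neg) :
  ((forall (U : approxSpace) (v : valuation Sim U), (v alpha <= v beta)%O) <->
   (forall U : approxSpace, entails1 U alpha beta)) /\
  ((forall (U : approxSpace) (v : valuation Neg U), (v gamma <= v delta)%O) <->
   (forall U : approxSpace, entails0 U gamma delta)).
Proof.
by split; split=> h U; [apply/le_entails1 | apply/le_entails1
  | apply/le_entails0 | apply/le_entails0]; apply: h.
Qed.
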